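(* Let $(X^i,\mathcal{T}^i)_{i\in I}$ be a family of conditional topological spaces on $\mathcal{A}$ and let $X=\prod_i X^i$ be endowed with the conditional product topology. Then $X$ is conditionally compact if and only if $X^i$ is conditionally compact for every $i$.
   Context: $\mathcal{A}$ is a complete Boolean algebra with $0\ne1$; $p(a)$ is the set of families $(a_i)$ with $\bigvee a_i=a$, $a_i\wedge a_j=0$ ($i\ne j$). A conditional set $X=(X_a,\gamma_a)_{a\in\mathcal A}$ consists of sets and surjections $\gamma_a:X_1\to X_a$ ($X_0$ a singleton, $\gamma_1=\mathrm{id}$), consistent ($a\le b$, $\gamma_b(x)=\gamma_b(y)\Rightarrow\gamma_a(x)=\gamma_a(y)$) and stable (for $(a_i)\in p(1)$, $x_i\in X_{a_i}$ there is a unique $x\in X_1$ with $\gamma_{a_i}(x)=x_i$). Conditional subsets (living on $b$: non-empty subsets of $X_b$ closed under gluing over partitions in $p(b)$) form under $\sqsubseteq$ a complete Boolean algebra with join $\sqcup$, meet $\sqcap$, least element $\mathbf0$. A conditional topology on $X$ is a collection $\mathcal T$ of conditional subsets containing $\mathbf0$ and $X$, closed under gluing (for $(a_i)\in p(1)$, $O^i\in\mathcal T$: $\sqcup_i(O^i\sqcap a_iX)\in\mathcal T$, where $a_iX$ has primal set $X_{a_i}$), finite $\sqcap$ and arbitrary $\sqcup$. A conditional function $f:X\to Y$ is a family $f_a:X_a\to Y_a$ with $f_a(ax)=af_1(x)$; the conditional preimage of $V\sqsubseteq Y$ living on $b$ lives on $b_*=\bigvee\{c\le b:f_c^{-1}(V_c)\ne\emptyset\}$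 with primal set $f_{b_*}^{-1}(V_{b_*})$; $f$ is conditionally continuous if preimages of conditionally open sets are conditionally open. The conditional product of non-empty family $(X^i)$ is $\prod X^i=(\prod_iX^i_a,(\gamma^i_a)_i)_{a\in\mathcal{A}}$ with conditional projections $\pi^j$ given by the coordinate projections; the conditional product topology is the smallest conditional topology making all $\pi^j$ conditionally continuous. Conditional compactness: $X$ is conditionally compact if for every conditional family $(O^j)_{j\in J}$ of open sets (a conditional function from a conditional index set $J$) with $X\sqsubseteq\sqcup_j O^j$ there are $(a_i)\in p(1)$ and finite $J^i\subseteq J_1$ such that $a_iX\sqsubseteq \sqcup_{j\in J^i}(O^j\sqcap a_iX)$ for every $i$ (i.e. a conditionally finite subfamily conditionally covers $X$). *)

(* Defs.v *)
From HB Require Import structures.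
From mathcomp Require Import all_boot all_order.
From mathcomp Require Import boolp classical_sets functions cardinality.

Set Implicit Arguments.
Unset Strict Implicit.
Unset Printing Implicit Defensive.

Import Order.Theory.
Local Open Scope classical_set_scope.
Local Open Scope order_scope.

(* The axiom 0 <> 1 is not part of the structure. *)
HB.mixin Record hasLub d T of Order.CTBDistrLattice d T := {
  lub_exists : forall S : set T, exists m : T, isLub S m
}.

#[short(type="completeBAType")]
HB.structure Definition CompleteBA d :=
  {T of hasLub d T & Order.CTBDistrLattice d T}.

Definition lub d (A : completeBAType d) (S : set A) : A :=
  projT1 (cid (lub_exists S)).

(* [partition_of b a] says that (a_k)_k is in p(b); members may be \bot. *)
Definition partition_of d (A : completeBAType d) (b : A) (K : Type)
    (a : K -> A) : Prop :=
  lub (range a) = b /\ forall k l, k <> l -> a k `&` a l = \bot.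

Section Lub.
Context d (A : completeBAType d).
Implicit Types (S C : set A) (a b c u : A).

Lemma lubP S : isLub S (lub S).
Proof. by rewrite /lub; case: cid. Qed.

Lemma lub_ub S a : S a -> a <= lub S.
Proof. by have [h _] := lubP S; apply: h. Qed.

Lemma lub_le S u : (forall a, S a -> a <= u) -> lub S <= u.
Proof. by have [_ h] := lubP S; apply: h. Qed.

Lemma le_residual a b u : (a `&` b <= u) = (b <= (~` a) `|` u).
Proof.
apply/idP/idP => h.
  have -> : b = (b `&` ~` a) `|` (b `&` a).
    by rewrite -meetUr joinC joinxC meetx1.
  by apply: leU2; rewrite ?leIr // meetC.
apply: (le_trans (leI2 (lexx a) h)).
by rewrite meetUr meetxC join0x leIr.
Qed.

Lemma lub_meet_le S a u : (forall b, S b -> a `&` b <= u) -> a `&` lub S <= u.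
Proof.
by move=> h; rewrite le_residual; apply: lub_le => b /h; rewrite le_residual.
Qed.

Lemma partition_le b K (a : K -> A) k : partition_of b a -> a k <= b.
Proof. by move=> [<- _]; apply: lub_ub; exists k. Qed.

Lemma partition_meet_le b K (a : K -> A) c u : partition_of b a -> c <= b ->
  (forall k, c `&` a k <= u) -> c <= u.
Proof.
move=> [pb _] cb h; rewrite -(meet_l cb) -pb.
by apply: lub_meet_le => _ [k _ <-].
Qed.

Lemma exhaustion C : (forall a b, a <= b -> C b -> C a) ->
  exists (K : Type) (a : K -> A), partition_of (lub C) a /\ forall k, C (a k).
Proof.
move=> dC.
pose P := [set D : set A | (D `<=` C) /\
  forall x y, D x -> D y -> x <> y -> x `&` y = \bot].
have [F FP Ft|D [[DC Dd] Dmax]] := @Zorn_bigcup A P.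
  split=> [x [D /FP [DC _] /DC]//|x y [D FD Dx] [E FE Ey] xy].
  have [DE|ED] := Ft _ _ FD FE.
  - by have [_ h] := FP _ FE; apply: h => //; apply: DE.
  - by have [_ h] := FP _ FD; apply: h => //; apply: ED.
exists {x | D x}, (fun k => sval k); split; last by move=> [x Dx] /=; apply: DC.
split; last first.
  move=> [x Dx] [y Dy] xy /=; apply: Dd => // exy; apply: xy.
  exact: eq_exist.
apply/le_anti/andP; split.
  by apply: lub_le => _ [[x Dx] _ <-] /=; apply/lub_ub/DC.
set u := (X in _ <= X); have uD x : D x -> x <= u.
  by move=> Dx; apply: lub_ub; exists (exist _ x Dx).
apply: lub_le => c Cc; apply: contrapT => /negP ncu.
pose c' := c `&` ~` u.
have c'0 : c' <> \bot.
  by move=> /eqP; rewrite /c' disj_leC complK (negbTE ncu).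
have Dc' x : D x -> x `&` c' = \bot.
  move=> /uD xu; apply/eqP; rewrite -lex0 /c' meetCA.
  by apply: (le_trans (leIr _ _)); rewrite lex0 disj_leC complK.
apply: (Dmax [set x | D x \/ x = c']).
  split; first by move=> x; left.
  move=> /(_ c') /= h; have /uD := h (or_intror erefl).
  move=> c'u; apply: c'0; apply/eqP; rewrite -lex0 -(meetxC u) lexI c'u.
  exact: leIr.
split=> [x [/DC//|->]|x y]; first by apply: dC Cc; exact: leIl.
move=> [Dx|->] [Dy|->] // xy; [exact: Dd|exact: Dc'|rewrite meetC; exact: Dc'].
Qed.

End Lub.

Section CSet.
Context d (A : completeBAType d).

Record cset := CSet {
  csort :> A -> Type ;
  cond : forall a, csort \top -> csort a ;
  cset0 : exists x : csort \bot, forall y, y = x ;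
  cond_surj : forall a (x : csort a), exists y, cond a y = x ;
  cond1 : forall x, cond \top x = x ;
  cond_consistent : forall (a b : A) (x y : csort \top),
    a <= b -> cond b x = cond b y -> cond a x = cond a y ;
  cond_stable : forall (K : Type) (a : K -> A), partition_of \top a ->
    forall x : (forall k, csort (a k)),
    exists! y : csort \top, forall k, cond (a k) y = x k
}.

(* The map X_b -> X_a induced by consistency; meaningful only for a <= b. *)
Definition res (X : cset) (b a : A) (x : X b) : X a :=
  cond a (projT1 (cid (cond_surj x))).

Lemma res_cond (X : cset) (a b : A) (x : X \top) :
  a <= b -> res a (cond b x) = cond a x.
Proof. by rewrite /res => ab; case: cid => y /= /(cond_consistent ab). Qed.

Lemma condE (X : cset) (a : A) (x : X a) : exists y : X \top, x = cond a y.
Proof. by have [y <-] := cond_surj x; exists y. Qed.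

Lemma res_res (X : cset) (a b c : A) (x : X c) :
  a <= b -> b <= c -> res a (res b x) = res a x.
Proof.
move=> ab bc; have [y ->] := condE x.
by rewrite !res_cond // (le_trans ab).
Qed.

Lemma res_id (X : cset) (a : A) (x : X a) : res a x = x.
Proof. by have [y ->] := condE x; rewrite res_cond. Qed.

Lemma res1 (X : cset) (a : A) (x : X \top) : res a x = cond a x.
Proof. by rewrite -{1}(cond1 x) res_cond ?lex1. Qed.

Lemma csort0_eq (X : cset) (x y : X \bot) : x = y.
Proof. by have [z h] := cset0 X; rewrite (h x) (h y). Qed.

Lemma partition_ext (b : A) K (a : K -> A) : partition_of b a ->
  partition_of \top (oapp a (~` b)).
Proof.
move=> pb; have ab k := partition_le k pb; case: (pb) => lb db; split.
  apply/eqP; rewrite -le1x -(joinxC b) leUx; apply/andP; split.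
    by rewrite -{1}lb; apply: lub_le => _ [k _ <-]; apply: lub_ub; exists (Some k).
  by apply: lub_ub; exists None.
move=> [k|] [l|] //= kl.
- by apply: db => e; apply: kl; rewrite e.
- by apply/eqP; rewrite disj_leC complK.
- by apply/eqP; rewrite meetC disj_leC complK.
Qed.

Lemma glue_exists (X : cset) (b : A) K (a : K -> A) (x : forall k, X (a k)) :
  partition_of b a -> exists y : X b, forall k, res (a k) y = x k.
Proof.
move=> pb; have [z0 _] := cset0 X; have [z _] := condE z0.
pose x' (k : option K) : X (oapp a (~` b) k) :=
  match k with Some k => x k | None => cond _ z end.
have [y [yx _]] := cond_stable (partition_ext pb) x'.
exists (cond b y) => k; rewrite res_cond ?(partition_le _ pb) //.
exact: (yx (Some k)).
Qed.

Lemma glue_unique (X : cset) (b : A) K (a : K -> A) (x y : X b) :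
  partition_of b a -> (forall k, res (a k) x = res (a k) y) -> x = y.
Proof.
move=> pb xy; have [x' ex] := condE x; have pT := partition_ext pb.
have pb2 : partition_of \top (fun c : bool => if c then b else ~` b).
  split.
    apply/eqP; rewrite -le1x -(joinxC b) leUx.
    by apply/andP; split; apply: lub_ub; [exists true|exists false].
  by move=> [] [] //= _; rewrite ?meetxC // meetC meetxC.
pose s (c : bool) : X (if c then b else ~` b) :=
  if c return X (if c then b else ~` b) then y else cond _ x'.
have [v [vv _]] := cond_stable pb2 s.
have [z [_ zu]] := cond_stable pT (fun k => cond _ x').
suff vx : v = x' by rewrite ex -vx; exact: (vv true).
rewrite -(zu x') //; apply/esym/zu => -[k|]; last exact: (vv false).
rewrite /= -(@res_cond _ (a k) b) ?(partition_le _ pb) // (vv true) /=.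
by rewrite -xy ex res_cond // (partition_le _ pb).
Qed.

(* The conditional subset living on [dom] with primal set [prim]. *)
Record csub (X : cset) := CSub {
  dom : A ;
  prim : set (X dom) ;
  prim_neq0 : (prim !=set0) ;
  prim_glue : forall (K : Type) (a : K -> A), partition_of dom a ->
    forall (y : K -> X dom) (x : X dom), (forall k, prim (y k)) ->
    (forall k, res (a k) x = res (a k) (y k)) -> prim x
}.

Arguments prim [X] V _ : rename.

(* The set V_c, for c <= dom V. *)
Definition csub_at (X : cset) (V : csub X) (c : A) : set (X c) :=
  [set res c y | y in prim V].

Arguments csub_at [X] V c _.

Definition csubset (X : cset) (V W : csub X) : Prop :=
  dom V <= dom W /\ (prim V `<=` csub_at W (dom V)).

Section CSub.
Variable X : cset.
Implicit Types V W : csub X.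

Definition csub_in V c (x : X c) : Prop := c <= dom V /\ csub_at V c x.

Lemma csub_inP V (x : X (dom V)) : csub_in V x <-> prim V x.
Proof.
split=> [[_ [y Vy <-]]|Vx]; first by rewrite res_id.
by split=> //; exists x; rewrite ?res_id.
Qed.

Lemma csub_in_dom V c (x : X c) : csub_in V x -> c <= dom V.
Proof. by case. Qed.

Lemma csub_in_res V b c (x : X c) : b <= c -> csub_in V x -> csub_in V (res b x).
Proof.
move=> bc [cV [y Vy <-]]; split; first exact: le_trans cV.
by exists y => //; rewrite res_res.
Qed.

Lemma csub_in_glue V c K (a : K -> A) (x : X c) : partition_of c a ->
  (forall k, csub_in V (res (a k) x)) -> csub_in V x.
Proof.
move=> pc h; have ac k := partition_le k pc.
have cV : c <= dom V by case: (pc) => <- _; apply: lub_le => _ [k _ <-]; case: (h k).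
split=> //.
have [y yP] : {y : K -> X (dom V) |
    forall k, prim V (y k) /\ res (a k) (y k) = res (a k) x}.
  have e k : exists y, prim V y /\ res (a k) y = res (a k) x.
    by case: (h k) => _ [y Vy e]; exists y.
  by exists (fun k => projT1 (cid (e k))) => k; case: cid.
have [y0 Vy0] := prim_neq0 V.
pose a' (k : option K) := oapp a (dom V `&` ~` c) k.
have pV : partition_of (dom V) a'.
  split.
    apply/le_anti/andP; split.
      by apply: lub_le => _ [[k|] _ <-] /=; [exact: le_trans (ac k) cV|exact: leIl].
    have {1}-> : dom V = c `|` (dom V `&` ~` c).
      by rewrite joinIr joinxC meetx1; apply/esym/join_r.
    rewrite leUx; apply/andP; split; last by apply: lub_ub; exists None.
    by case: (pc) => {1}<- _; apply: lub_le => _ [k _ <-]; apply: lub_ub; exists (Some k).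
  have dis k : a k `&` (dom V `&` ~` c) = \bot.
    apply/eqP; rewrite -lex0 meetCA; apply: (le_trans (leIr _ _)).
    by rewrite lex0 disj_leC complK.
  move=> [k|] [l|] //= kl; last by rewrite meetC.
  by case: (pc) => _ dc; apply: dc => e; apply: kl; rewrite e.
pose y' (k : option K) := oapp y y0 k.
have [z zP] := glue_exists (fun k => res (a' k) (y' k)) pV.
exists z.
  apply: (prim_glue pV (y := y')) => // -[k|] //=; by case: (yP k).
apply: (glue_unique pc) => k; rewrite res_res //.
by rewrite (zP (Some k)) /=; case: (yP k).
Qed.

Lemma csub_in_cover V c (x : X c) (C : set A) : c <= lub C ->
  (forall b, C b -> csub_in V (res (c `&` b) x)) -> csub_in V x.
Proof.
move=> cC h.
pose C' := [set b | b <= c /\ csub_in V (res b x)].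
have [b1 b2 b12 [bc Vb]|K [a [pa aC]]] := @exhaustion _ A C'.
  split; first exact: le_trans bc.
  by rewrite -(res_res _ b12 bc); apply: csub_in_res.
have ec : lub C' = c.
  apply/le_anti/andP; split; first by apply: lub_le => b [].
  rewrite -{1}(meet_l cC); apply: lub_meet_le => b Cb.
  by apply: lub_ub; split; [exact: leIl|exact: h].
by rewrite ec in pa; apply: (csub_in_glue pa) => k; case: (aC k).
Qed.

Lemma csub_in0 V (x : X \bot) : csub_in V x.
Proof.
split; first exact: le0x.
by have [y Vy] := prim_neq0 V; exists y => //; exact: csort0_eq.
Qed.

Lemma csubsetP V W :
  csubset V W <-> forall c (x : X c), csub_in V x -> csub_in W x.
Proof.
split=> [[VW h] c x [cV [y Vy <-]]|h].
  apply: csub_in_res => //; split=> //; exact: h.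
have [y /csub_inP Vy] := prim_neq0 V.
split; first by have [] := h _ _ Vy.
by move=> x /csub_inP /h [].
Qed.

Lemma csubset_refl V : csubset V V.
Proof. exact/csubsetP. Qed.

Lemma csubset_trans V W U : csubset V W -> csubset W U -> csubset V U.
Proof.
move=> /csubsetP h /csubsetP k; apply/csubsetP => c x ?; exact/k/h.
Qed.

Lemma csubset_anti V W : csubset V W -> csubset W V -> V = W.
Proof.
case: V W => [a S neS gS] [b T neT gT] [/= ab h] [/= ba k].
have e : a = b by apply/le_anti/andP.
subst b; have eS : S = T.
  by apply/seteqP; split=> x; [move=> /h|move=> /k] => -[y /= ? <-]; rewrite res_id.
by subst T; congr CSub; exact: Prop_irrelevance.
Qed.

Lemma csub_ext V W : (forall c (x : X c), csub_in V x <-> csub_in W x) -> V = W.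
Proof.
by move=> h; apply: csubset_anti; apply/csubsetP => c x /h.
Qed.

(* A predicate compatible with restriction and gluing is realised on the
   supremum of the conditions on which it is satisfiable. *)
Lemma local_neq0 (S : forall c, set (X c)) :
  (forall b c (x : X c), b <= c -> S c x -> S b (res b x)) ->
  (forall c K (a : K -> A) (x : X c), partition_of c a ->
     (forall k, S (a k) (res (a k) x)) -> S c x) ->
  (S (lub [set c | S c !=set0]) !=set0).
Proof.
move=> Sr Sg; have [b c bc [x Sx]|K [a [pa aS]]] :=
    @exhaustion _ A [set c | S c !=set0].
  by exists (res b x); apply: Sr.
have [x xP] : {x : forall k, X (a k) | forall k, S (a k) (x k)}.
  by exists (fun k => projT1 (cid (aS k))) => k; case: cid.
have [y yP] := glue_exists x pa.
by exists y; apply: (Sg _ _ _ _ pa) => k; rewrite yP.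
Qed.

(* The conditional subset aX, with primal set X_a. *)
Lemma cX_neq0 (a : A) : ([set: X a] !=set0).
Proof. by have [x0 _] := cset0 X; have [y _] := condE x0; exists (cond a y). Qed.

Definition cX (a : A) : csub X :=
  CSub (cX_neq0 a) (fun _ _ _ _ _ _ _ => I).

Definition cbot : csub X := cX \bot.

Lemma in_cX a c (x : X c) : csub_in (cX a) x <-> c <= a.
Proof.
split=> [[]//|ca]; split=> //.
have [y ->] := condE x; exists (cond a y) => //; exact: res_cond.
Qed.

Definition cmeet_dom V W : A :=
  lub [set c | c <= dom V `&` dom W /\ (csub_at V c `&` csub_at W c !=set0)].

Definition cmeet_prim V W : set (X (cmeet_dom V W)) :=
  (csub_at V (cmeet_dom V W) `&` csub_at W (cmeet_dom V W)).

Arguments cmeet_prim V W _ : clear implicits.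

Lemma cmeet_domE V W : cmeet_dom V W =
  lub [set c | [set x : X c | csub_in V x /\ csub_in W x] !=set0].
Proof.
congr lub; apply/seteqP; split=> c /=.
  by rewrite lexI => -[/andP[cV cW] [x [Vx Wx]]]; exists x.
by move=> [x [[cV Vx] [cW Wx]]]; rewrite lexI cV cW; split=> //; exists x.
Qed.

Lemma cmeet_dom_le V W : cmeet_dom V W <= dom V /\ cmeet_dom V W <= dom W.
Proof.
by split; apply: lub_le => c [+ _]; rewrite lexI => /andP[].
Qed.

Lemma cmeet_primE V W x : cmeet_prim V W x <-> csub_in V x /\ csub_in W x.
Proof.
by have [] := cmeet_dom_le V W; rewrite /csub_in; split=> [[]|[[? ?] []]].
Qed.

Lemma cmeet_neq0 V W : (cmeet_prim V W !=set0).
Proof.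
pose S c := [set x : X c | csub_in V x /\ csub_in W x].
have Sr b c (x : X c) : b <= c -> S c x -> S b (res b x).
  by move=> bc [? ?]; split; apply: csub_in_res.
have Sg c K (a : K -> A) (x : X c) : partition_of c a ->
     (forall k, S (a k) (res (a k) x)) -> S c x.
  by move=> pa h; split; apply: (csub_in_glue pa) => k; case: (h k).
have := local_neq0 Sr Sg; rewrite -cmeet_domE => -[x Sx].
by exists x; apply/cmeet_primE.
Qed.

Lemma cmeet_glue V W K (a : K -> A) : partition_of (cmeet_dom V W) a ->
  forall (y : K -> X (cmeet_dom V W)) x, (forall k, cmeet_prim V W (y k)) ->
  (forall k, res (a k) x = res (a k) (y k)) -> cmeet_prim V W x.
Proof.
move=> pa y x Sy xy; apply/cmeet_primE.
split; apply: (csub_in_glue pa) => k; rewrite xy;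
  apply: csub_in_res; rewrite ?(partition_le _ pa) //;
  by have /cmeet_primE[] := Sy k.
Qed.

Definition cmeet V W : csub X := CSub (cmeet_neq0 V W) (@cmeet_glue V W).

Lemma in_cmeet V W c (x : X c) :
  csub_in (cmeet V W) x <-> csub_in V x /\ csub_in W x.
Proof.
split=> [|[Vx Wx]].
  move=> [cm [y /cmeet_primE[Vy Wy] <-]]; split; exact: csub_in_res.
have cm : c <= dom (cmeet V W).
  by rewrite /= cmeet_domE; apply: lub_ub; exists x.
have [y Sy] := cmeet_neq0 V W.
have pc : partition_of (dom (cmeet V W)) (fun t : bool =>
    if t then c else dom (cmeet V W) `&` ~` c).
  split.
    apply/le_anti/andP; split.
      by apply: lub_le => _ [[] _ <-] //; exact: leIl.
    have {1}-> : dom (cmeet V W) = c `|` (dom (cmeet V W) `&` ~` c).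
      by rewrite joinIr joinxC meetx1; apply/esym/join_r.
    by rewrite leUx; apply/andP; split; apply: lub_ub; [exists true|exists false].
  have e : c `&` (dom (cmeet V W) `&` ~` c) = \bot.
    by rewrite meetCA meetxC meetx0.
  by move=> [] [] //= _; rewrite // meetC.
pose t (k : bool) : X (if k then c else dom (cmeet V W) `&` ~` c) :=
  if k return X (if k then c else dom (cmeet V W) `&` ~` c)
  then x else res _ y.
have [z zP] := glue_exists t pc.
split=> //; exists z; last exact: (zP true).
have /cmeet_primE[Vy Wy] := Sy.
apply/cmeet_primE; split; apply: (csub_in_glue pc) => -[];
  rewrite ?(zP true) ?(zP false) //=; apply: csub_in_res => //; exact: leIl.
Qed.

Definition cjoin_dom (F : set (csub X)) : A :=
  lub [set dom V | V in F].

(* The gluings along partitions of members of the elements of F. *)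
Definition cjoin_prim (F : set (csub X)) : set (X (cjoin_dom F)) :=
  [set x | exists (K : Type) (a : K -> A) (V : K -> csub X),
     partition_of (cjoin_dom F) a /\
     forall k, [/\ F (V k), a k <= dom (V k) & csub_at (V k) (a k) (res (a k) x)]].

Arguments cjoin_prim F _ : clear implicits.

Definition covered (F : set (csub X)) c (x : X c) : Prop :=
  c <= lub [set b | b <= c /\ exists2 V, F V & csub_in V (res b x)].

Lemma covered_part F c (x : X c) : covered F x <->
  exists (K : Type) (a : K -> A) (V : K -> csub X), partition_of c a /\
     forall k, [/\ F (V k), a k <= dom (V k) & csub_at (V k) (a k) (res (a k) x)].
Proof.
split=> [cx|[K [a [V [pc h]]]]]; last first.
  case: (pc) => ec _; rewrite /covered -{1}ec; apply: lub_le => _ [k _ <-].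
  apply: lub_ub; split; first exact: partition_le pc.
  by have [FV kV Vx] := h k; exists (V k).
rewrite /covered in cx; set C := mkset _ in cx.
have ec : lub C = c.
  by apply/le_anti; rewrite cx andbT; apply: lub_le => b [].
have [b1 b2 b12 [bc [V FV Vb]]|K [a [pa aC]]] := @exhaustion _ A C.
  split; first exact: le_trans bc.
  by exists V => //; rewrite -(res_res _ b12 bc); apply: csub_in_res.
exists K, a, (fun k => s2val (cid2 (aC k).2)).
rewrite ec in pa; split=> // k.
by case: cid2 => V /= FV [].
Qed.

Lemma covered_res F b c (x : X c) : b <= c -> covered F x -> covered F (res b x).
Proof.
move=> bc; rewrite /covered => cx.
rewrite -{1}(meet_l (le_trans bc cx)); apply: lub_meet_le => e [ec [V FV Ve]].
apply: lub_ub; split; first exact: leIl.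
exists V => //; rewrite res_res ?leIl // -(@res_res _ _ e) ?leIr //.
by apply: csub_in_res => //; exact: leIr.
Qed.

Lemma covered_glue F c K (a : K -> A) (x : X c) : partition_of c a ->
  (forall k, covered F (res (a k) x)) -> covered F x.
Proof.
move=> pc h; rewrite /covered; case: (pc) => {1}<- _.
apply: lub_le => _ [k _ <-]; apply: (le_trans (h k)).
apply: lub_le => b [bk [V FV Vb]].
have kc := partition_le k pc.
apply: lub_ub; split; first exact: le_trans kc.
by exists V => //; rewrite res_res in Vb.
Qed.

Lemma cjoin_primE F (x : X (cjoin_dom F)) : cjoin_prim F x <-> covered F x.
Proof. by rewrite covered_part. Qed.

Lemma csub_in_covered (F : set (csub X)) V c (x : X c) :
  F V -> csub_in V x -> covered F x.
Proof.
by move=> FV Vx; apply: lub_ub; split=> //; exists V; rewrite ?res_id.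
Qed.

Lemma covered_dom F c (x : X c) : covered F x -> c <= cjoin_dom F.
Proof.
move=> cx; apply: (le_trans cx); apply: lub_le => b [_ [V FV [bV _]]].
by apply: (le_trans bV); apply: lub_ub; exists V.
Qed.

Lemma cjoin_neq0 F : (cjoin_prim F !=set0).
Proof.
have := @local_neq0 (fun c => [set x | covered F x])
  (@covered_res F) (@covered_glue F).
set e := lub _; suff -> : e = cjoin_dom F.
  by move=> [x Fx]; exists x; apply/cjoin_primE.
apply/le_anti/andP; split; first by apply: lub_le => c [x /covered_dom].
apply: lub_le => _ [V FV <-]; apply: lub_ub.
have [x /csub_inP Vx] := prim_neq0 V.
by exists x; exact: csub_in_covered Vx.
Qed.

Lemma cjoin_glue F K (a : K -> A) : partition_of (cjoin_dom F) a ->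
  forall (y : K -> X (cjoin_dom F)) x, (forall k, cjoin_prim F (y k)) ->
  (forall k, res (a k) x = res (a k) (y k)) -> cjoin_prim F x.
Proof.
move=> pa y x Sy xy; apply/cjoin_primE/(covered_glue pa) => k; rewrite xy.
by apply: covered_res; [exact: partition_le pa|exact/cjoin_primE].
Qed.

Definition cjoin F : csub X := CSub (@cjoin_neq0 F) (@cjoin_glue F).

Lemma in_cjoin F c (x : X c) : csub_in (cjoin F) x <-> covered F x.
Proof.
split=> [[cF [y /cjoin_primE Fy <-]]|Fx]; first exact: covered_res.
apply: (@csub_in_cover _ _ _ _ Fx) => b [bc [V FV Vb]].
rewrite (meet_r bc).
suff /csubsetP h : csubset V (cjoin F) by exact: h.
split; first by apply: lub_ub; exists V.
move=> z /csub_inP Vz.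
have [w Fw] := cjoin_neq0 F.
have VF : dom V <= cjoin_dom F by apply: lub_ub; exists V.
have pc : partition_of (cjoin_dom F) (fun t : bool =>
    if t then dom V else cjoin_dom F `&` ~` dom V).
  split.
    apply/le_anti/andP; split.
      by apply: lub_le => _ [[] _ <-] //; exact: leIl.
    have {1}-> : cjoin_dom F = dom V `|` (cjoin_dom F `&` ~` dom V).
      by rewrite joinIr joinxC meetx1; apply/esym/join_r.
    by rewrite leUx; apply/andP; split; apply: lub_ub; [exists true|exists false].
  have e : dom V `&` (cjoin_dom F `&` ~` dom V) = \bot.
    by rewrite meetCA meetxC meetx0.
  by move=> [] [] //= _; rewrite // meetC.
pose t (k : bool) : X (if k then dom V else cjoin_dom F `&` ~` dom V) :=
  if k return X (if k then dom V else cjoin_dom F `&` ~` dom V)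
  then z else res _ w.
have [v vP] := glue_exists t pc.
exists v; last exact: (vP true).
apply/cjoin_primE/(covered_glue pc) => -[].
  by rewrite (vP true); exact: csub_in_covered Vz.
rewrite (vP false); apply: covered_res; [exact: leIl|exact/cjoin_primE].
Qed.

Lemma cmeet_glb V W U :
  csubset U (cmeet V W) <-> csubset U V /\ csubset U W.
Proof.
rewrite !csubsetP; split=> [h|[h k] c x Ux].
  by split=> c x /h /in_cmeet[].
by apply/in_cmeet; split; [exact: h|exact: k].
Qed.

Lemma cjoin_lub F U :
  csubset (cjoin F) U <-> forall V, F V -> csubset V U.
Proof.
split=> [/csubsetP h V FV|h].
  apply/csubsetP => c x Vx; apply: h; apply/in_cjoin; exact: csub_in_covered Vx.
apply/csubsetP => c x /in_cjoin Fx; apply: (csub_in_cover Fx) => b [bc [V FV Vb]].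
by have /csubsetP k := h V FV; rewrite (meet_r bc); apply: k.
Qed.

End CSub.

Record cfun (X Y : cset) := CFun {
  cfun_at :> forall a, X a -> Y a ;
  cfun_cond : forall a (x : X \top), cfun_at (cond a x) = cond a (cfun_at x)
}.

Section Preimage.
Context (X Y : cset) (f : cfun X Y).

Lemma cfun_res (a b : A) (x : X b) : a <= b -> f a (res a x) = res a (f b x).
Proof.
by move=> ab; have [y ->] := condE x; rewrite res_cond // !cfun_cond res_cond.
Qed.

Definition cpreim_dom (V : csub Y) : A :=
  lub [set c | c <= dom V /\ (f c @^-1` csub_at V c !=set0)].

Definition cpreim_prim (V : csub Y) : set (X (cpreim_dom V)) :=
  (f (cpreim_dom V) @^-1` csub_at V (cpreim_dom V)).

Arguments cpreim_prim V _ : clear implicits.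

Lemma cpreim_primE V x : cpreim_prim V x <-> csub_in V (f _ x).
Proof.
split=> [Vx|[]//]; split=> //; by apply: lub_le => c [].
Qed.

Lemma cpreim_neq0 V : (cpreim_prim V !=set0).
Proof.
pose S c := [set x : X c | csub_in V (f c x)].
have Sr b c (x : X c) : b <= c -> S c x -> S b (res b x).
  by move=> bc Sx; rewrite /S/= cfun_res //; apply: csub_in_res.
have Sg c K (a : K -> A) (x : X c) : partition_of c a ->
     (forall k, S (a k) (res (a k) x)) -> S c x.
  move=> pa h; apply: (csub_in_glue pa) => k; rewrite -cfun_res ?(partition_le _ pa) //.
  exact: h.
have := local_neq0 Sr Sg; set e := lub _; suff -> : e = cpreim_dom V.
  by move=> [x Sx]; exists x; apply/cpreim_primE.
congr lub; apply/seteqP; split=> c /=.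
  by move=> [x [cV Vx]]; split=> //; exists x.
by move=> [cV [x Vx]]; exists x.
Qed.

Lemma cpreim_glue V K (a : K -> A) : partition_of (cpreim_dom V) a ->
  forall (y : K -> X (cpreim_dom V)) x, (forall k, cpreim_prim V (y k)) ->
  (forall k, res (a k) x = res (a k) (y k)) -> cpreim_prim V x.
Proof.
move=> pa y x Sy xy; apply/cpreim_primE/(csub_in_glue pa) => k.
have ka := partition_le k pa.
rewrite -cfun_res // xy cfun_res //; apply: csub_in_res => //.
exact/cpreim_primE.
Qed.

Definition cpreim (V : csub Y) : csub X :=
  CSub (cpreim_neq0 V) (@cpreim_glue V).

End Preimage.

Section CPow.
Variable X : cset.

Definition cpow_sort (a : A) : Type := {V : csub X | dom V <= a}.

Definition cpow_in (a : A) (V : csub X) (h : dom V <= a) : cpow_sort a :=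
  exist _ V h.

Lemma cmeet_cX_dom (a : A) (V : csub X) : dom (cmeet V (cX X a)) <= a.
Proof. by have [] := cmeet_dom_le V (cX X a). Qed.

Definition cpow_cond (a : A) (V : cpow_sort \top) : cpow_sort a :=
  cpow_in (cmeet_cX_dom a (sval V)).

Lemma cpow_ext a (V W : cpow_sort a) : sval V = sval W -> V = W.
Proof. by case: V W => [V p] [W q] /= e; exact: eq_exist. Qed.

Lemma cmeet_cX_id (a : A) (V : csub X) : dom V <= a -> cmeet V (cX X a) = V.
Proof.
move=> Va; apply: csub_ext => c x; split=> [/in_cmeet[]//|Vx].
by apply/in_cmeet; split=> //; apply/in_cX; apply: le_trans Va; case: Vx.
Qed.

Lemma cpow_cset0 : exists V : cpow_sort \bot, forall W, W = V.
Proof.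
have h : dom (cbot X) <= \bot :> A by [].
exists (cpow_in h) => -[W W0]; apply: cpow_ext => /=; apply: csub_ext => c x.
split=> [[cW _]|[/= c0 _]]; first by apply/in_cX; exact: le_trans W0.
by rewrite lex0 in c0; move/eqP: c0 x => -> x; exact: csub_in0.
Qed.

Lemma cpow_surj a (V : cpow_sort a) : exists W, cpow_cond a W = V.
Proof.
case: V => V Va; exists (cpow_in (lex1 (dom V))).
by apply: cpow_ext => /=; exact: cmeet_cX_id.
Qed.

Lemma cpow_cond1 V : cpow_cond \top V = V.
Proof. by apply: cpow_ext => /=; apply: cmeet_cX_id; exact: lex1. Qed.

Lemma cpow_consistent (a b : A) (V W : cpow_sort \top) :
  a <= b -> cpow_cond b V = cpow_cond b W -> cpow_cond a V = cpow_cond a W.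
Proof.
move=> ab e0; have e : cmeet (sval V) (cX X b) = cmeet (sval W) (cX X b).
  exact: (congr1 (fun U => sval U) e0).
apply: cpow_ext => /=; apply: csub_ext => c x.
have h U : csub_in (cmeet U (cX X a)) x <->
    csub_in (cmeet U (cX X b)) x /\ c <= a.
  split=> [/in_cmeet[Ux /in_cX ca]|[/in_cmeet[Ux _] ca]].
    by split=> //; apply/in_cmeet; split=> //; apply/in_cX; exact: le_trans ab.
  by apply/in_cmeet; split=> //; apply/in_cX.
by rewrite !h e.
Qed.

Lemma cpow_stable (K : Type) (a : K -> A) : partition_of \top a ->
  forall V : (forall k, cpow_sort (a k)),
  exists! W : cpow_sort \top, forall k, cpow_cond (a k) W = V k.
Proof.
move=> pa V; pose F := range (fun k => sval (V k)).
pose W0 := cpow_in (lex1 (dom (cjoin F))).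
have hW0 k : cpow_cond (a k) W0 = V k.
  apply: cpow_ext => /=; apply: csub_ext => c x; split.
    move=> /in_cmeet[/in_cjoin Fx /in_cX ck].
    apply: (csub_in_cover Fx) => b [bc [_ [l _ <-] Vb]]; rewrite (meet_r bc).
    have [<-//|lk] := pselect (l = k).
    have b0 : b <= \bot.
      rewrite -(proj2 pa _ _ lk) lexI (le_trans bc ck) andbT.
      by apply: (le_trans (csub_in_dom Vb)); exact: (svalP (V l)).
    rewrite lex0 in b0; move/eqP: b0 => b0; subst b; exact: csub_in0.
  move=> Vx; apply/in_cmeet; split.
    by apply/in_cjoin; apply: csub_in_covered Vx; exists k.
  by apply/in_cX; apply: (le_trans (csub_in_dom Vx)); exact: (svalP (V k)).
exists W0; split=> //.
suff h (W W' : cpow_sort \top) : (forall k, cpow_cond (a k) W = V k) ->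
    (forall k, cpow_cond (a k) W' = V k) ->
    forall c (x : X c), csub_in (sval W) x -> csub_in (sval W') x.
  by move=> W hW; apply: cpow_ext; apply: csub_ext => c x; split; apply: h.
move=> hW hW' c x Wx.
have cT : c <= lub (range a) by case: pa => -> _; exact: lex1.
apply: (csub_in_cover cT) => _ [k _ <-].
have e : cpow_cond (a k) W = cpow_cond (a k) W' by rewrite hW hW'.
have e' : cmeet (sval W) (cX X (a k)) = cmeet (sval W') (cX X (a k)).
  exact: (congr1 (fun U => sval U) e).
suff : csub_in (cmeet (sval W') (cX X (a k))) (res (c `&` a k) x).
  by move=> /in_cmeet[].
rewrite -e'; apply/in_cmeet; split; first by apply: csub_in_res => //; exact: leIl.
by apply/in_cX; exact: leIr.
Qed.

Definition cpow : cset :=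
  CSet cpow_cset0 cpow_surj cpow_cond1 cpow_consistent cpow_stable.

End CPow.

Record ctopology (X : cset) (T : set (csub X)) : Prop := CTopology {
  ctop_bot : T (cbot X) ;
  ctop_full : T (cX X \top) ;
  ctop_glue : forall (K : Type) (a : K -> A), partition_of \top a ->
    forall O : K -> csub X, (forall k, T (O k)) ->
    T (cjoin (range (fun k => cmeet (O k) (cX X (a k))))) ;
  ctop_meet : forall V W, T V -> T W -> T (cmeet V W) ;
  ctop_join : forall F : set (csub X), (F `<=` T) -> T (cjoin F)
}.

Record ctopspace := CTopSpace {
  cspace :> cset ;
  copen : set (csub cspace) ;
  copenP : ctopology copen
}.

Definition ccontinuous (X Y : cset) (TX : set (csub X)) (TY : set (csub Y))
    (f : cfun X Y) : Prop :=
  forall V, TY V -> TX (cpreim f V).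

(* The cover is a conditional function from a conditional set J to the
   conditional power set of X whose values at elements of J_1 are open. *)
Definition ccompact (X : ctopspace) : Prop :=
  forall (J : cset) (O : cfun J (cpow X)),
    (forall j : J \top, copen (sval (O \top j))) ->
    csubset (cX X \top) (cjoin (range (fun j : J \top => sval (O \top j)))) ->
    exists (K : Type) (a : K -> A) (J' : K -> set (J \top)),
      [/\ partition_of \top a, forall k, finite_set (J' k) &
        forall k, csubset (cX X (a k))
          (cjoin [set cmeet (sval (O \top j)) (cX X (a k)) | j in J' k])].

Section CProd.
Context (I : Type).

Section Sets.
Variable X : I -> cset.

Definition cprod_sort (a : A) : Type := forall i, X i a.

Definition cprod_cond (a : A) (x : cprod_sort \top) : cprod_sort a :=
  fun i => cond a (x i).

Lemma cprod_cset0 : exists x : cprod_sort \bot, forall y, y = x.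
Proof.
exists (fun i => projT1 (cid (cset0 (X i)))) => y.
by apply: functional_extensionality_dep => i; exact: csort0_eq.
Qed.

Lemma cprod_surj a (x : cprod_sort a) : exists y, cprod_cond a y = x.
Proof.
exists (fun i => projT1 (cid (cond_surj (x i)))).
by apply: functional_extensionality_dep => i; rewrite /cprod_cond; case: cid.
Qed.

Lemma cprod_cond1 x : cprod_cond \top x = x.
Proof. by apply: functional_extensionality_dep => i; exact: cond1. Qed.

Lemma cprod_consistent (a b : A) (x y : cprod_sort \top) :
  a <= b -> cprod_cond b x = cprod_cond b y -> cprod_cond a x = cprod_cond a y.
Proof.
move=> ab e; apply: functional_extensionality_dep => i.
apply: (cond_consistent ab); exact: (congr1 (fun z => z i) e).
Qed.

Lemma cprod_stable (K : Type) (a : K -> A) : partition_of \top a ->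
  forall x : (forall k, cprod_sort (a k)),
  exists! y : cprod_sort \top, forall k, cprod_cond (a k) y = x k.
Proof.
move=> pa x; have h i := cond_stable pa (fun k => x k i).
exists (fun i => projT1 (cid (h i))); split.
  move=> k; apply: functional_extensionality_dep => i; rewrite /cprod_cond.
  by case: cid => y /= [].
move=> y yx; apply: functional_extensionality_dep => i.
by case: cid => z /= [_ zu]; apply: zu => k; rewrite -yx.
Qed.

Definition cprod : cset := CSet cprod_cset0 cprod_surj cprod_cond1
  cprod_consistent cprod_stable.

Definition cproj (i : I) : cfun cprod (X i) :=
  @CFun cprod (X i) (fun a (x : cprod a) => x i) (fun a x => erefl).

End Sets.

Section Topology.
Variable X : I -> ctopspace.

Definition cprod_open : set (csub (cprod X)) :=
  [set O | forall T : set (csub (cprod X)), ctopology T ->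
     (forall i, ccontinuous T (@copen (X i)) (cproj X i)) -> T O].

Lemma cprod_open_ctopology : ctopology cprod_open.
Proof.
split.
- by move=> T /ctop_bot.
- by move=> T /ctop_full.
- by move=> K a pa O hO T tT cT; apply: (ctop_glue tT) => // k; exact: hO.
- by move=> V W hV hW T tT cT; apply: (ctop_meet tT); [exact: hV|exact: hW].
- by move=> F hF T tT cT; apply: (ctop_join tT) => V /hF; apply.
Qed.

Lemma cproj_continuous i : ccontinuous cprod_open (@copen (X i)) (cproj X i).
Proof. by move=> V oV T _; apply. Qed.

Definition ctop_prod : ctopspace := CTopSpace cprod_open_ctopology.

End Topology.
End CProd.

End CSet.

(* Main.v *)
(* A global point x of a conditional set and a conditional subset V have a
   Boolean truth value [x \in V] in the algebra, and V is determined by the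
   function x |-> [x \in V].  The truth value fincov F of "finitely many members
   of F cover" is the supremum of the conditions on which this happens, and
   compactness says that fincov F = 1 for every open cover F.

   For the product, enlarge an open cover F by Zorn's lemma to a maximal family M
   of open sets with fincov M = fincov F =: e.  On each factor, let M_i be the
   family of open sets whose preimages are in M; by compactness of X^i and the
   maximum principle some x_i satisfies [x_i \in \/ M_i] <= e.  The family of all
   V with [x \in V] <= fincov (M u {V}) is a conditional topology, and maximality
   of M makes the projections continuous for it, so it contains all product-open
   sets.  For V in M this reads [x \in V] <= e, and M covers x, whence e = 1. *)

Require Import Defs.
From HB Require Import structures.
From mathcomp Require Import all_boot all_order.
From mathcomp Require Import boolp classical_sets functions cardinality.

Set Implicit Arguments.
Unset Strict Implicit.
Unset Printing Implicit Defensive.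

Import Order.Theory.
Local Open Scope order_scope.

(** * Finite subsets of unions of chains *)

Section FiniteSets.
Local Open Scope classical_set_scope.

Lemma finite_set_induction (T : Type) (P : set T -> Prop) :
  P set0 -> (forall x D, P D -> P (x |` D)) ->
  forall D, finite_set D -> P D.
Proof.
move=> P0 PS D; have /= := @finite_seqP {classic T} D.
move=> h /h [s ->]; elim: s => [|x s IHs]; first by rewrite set_nil.
suff -> : [set` x :: s] = x |` [set` s] by exact: PS.
apply/seteqP; split=> y /=; rewrite inE.
  by move=> /orP[/eqP->|]; [left|right].
by move=> [->|->]; rewrite ?eqxx ?orbT.
Qed.

(** Members of a chain are comparable, so those containing the points of [G] merge one by one into a
    single member. The first alternative accounts for an empty [C]. *)
Lemma finite_subset_bigcup_chain (T : Type) (B : set T) (C : set (set T))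
    (G : set T) :
  total_on C subset -> finite_set G -> G `<=` B `|` \bigcup_(D in C) D ->
  G `<=` B \/ exists2 D, C D & G `<=` B `|` D.
Proof.
move=> Ct fG; move: G fG; apply: finite_set_induction => [|x G IHG] GC.
  by left.
have GB : G `<=` B `|` \bigcup_(D in C) D by move=> y Gy; apply: GC; right.
have [Bx|[E CE Ex]] := GC x (or_introl erefl).
  case: (IHG GB) => [{}GB|[D CD GD]]; [left|right; exists D => //].
    by move=> y [->|/GB].
  by move=> y [->|/GD//]; left.
right; case: (IHG GB) => [{}GB|[D CD GD]].
  by exists E => // y [->|/GB]; [right|left].
have [DE|ED] := Ct _ _ CD CE.
  by exists E => // y [->|/GD[|/DE]]; [right|left|right].
by exists D => // y [->|/GD//]; right; exact: ED.
Qed.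

End FiniteSets.

(** * Boolean-valued membership of global points *)

Section TruthValues.
Context d (A : completeBAType d).
Local Open Scope classical_set_scope.
Local Open Scope order_scope.

Lemma le_lub_top (S : set A) (a u : A) : lub S = \top ->
  (forall b, S b -> a `&` b <= u) -> a <= u.
Proof. by move=> S1 h; rewrite -(meetx1 a) -S1; exact: lub_meet_le. Qed.

Lemma le_compl_meet (a s : A) : a `&` ~` s <= \bot -> a <= s.
Proof. by rewrite meetC le_residual complK joinx0. Qed.

Section Truth.
Context (X : cset A).
Implicit Types (V W : csub X) (x y : X \top) (F G : set (csub X)).

Definition truth V x : A := lub [set e | csub_in V (cond e x)].

(** The supremum defining [truth] is attained because conditional subsets are closed under gluing;
    membership on [c] thus becomes an inequality in [A]. *)
Lemma csub_in_truth V c x : csub_in V (cond c x) <-> c <= truth V x.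
Proof.
split=> [Vx|cV]; first exact: lub_ub.
apply: (csub_in_cover cV) => b Vb.
rewrite res_cond ?leIl // -(res_cond _ (leIr b c)).
by apply: csub_in_res => //; exact: leIr.
Qed.

Lemma csubset_truth V W :
  csubset V W <-> forall x, truth V x <= truth W x.
Proof.
rewrite csubsetP; split=> [h x|h c y].
  by apply/csub_in_truth/h/csub_in_truth.
by have [x ->] := condE y; move=> /csub_in_truth Vx;
  apply/csub_in_truth/(le_trans Vx).
Qed.

Lemma truth_inj V W : (forall x, truth V x = truth W x) -> V = W.
Proof.
by move=> h; apply: csubset_anti; apply/csubset_truth => x; rewrite h.
Qed.

Lemma truth_unique V x a : (forall c, csub_in V (cond c x) <-> c <= a) ->
  truth V x = a.
Proof.
move=> h; apply/le_anti/andP; split; last by apply/csub_in_truth/h.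
by apply/h/csub_in_truth.
Qed.

Lemma truth_cX a x : truth (cX X a) x = a.
Proof. by apply: truth_unique => c; exact: in_cX. Qed.

Lemma truth_cmeet V W x : truth (cmeet V W) x = truth V x `&` truth W x.
Proof.
apply: truth_unique => c; rewrite in_cmeet !csub_in_truth lexI.
by split=> [[-> ->]//|/andP[]].
Qed.

Lemma truth_cjoin F x : truth (cjoin F) x = lub [set truth V x | V in F].
Proof.
apply: truth_unique => c; rewrite in_cjoin /covered; split=> h.
  apply: (le_trans h); apply: lub_le => b [bc [V FV]].
  rewrite res_cond // => /csub_in_truth Vb; apply: (le_trans Vb).
  by apply: lub_ub; exists V.
rewrite -{1}(meet_l h); apply: lub_meet_le => _ [V FV <-].
apply: lub_ub; split; first exact: leIl.
by exists V; rewrite // res_cond ?leIl //; apply/csub_in_truth; exact: leIr.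
Qed.

Lemma truth_cjoin_ub F V x : F V -> truth V x <= truth (cjoin F) x.
Proof. by move=> FV; rewrite truth_cjoin; apply: lub_ub; exists V. Qed.

Lemma truth_cjoin_le F x u :
  (forall V, F V -> truth V x <= u) -> truth (cjoin F) x <= u.
Proof.
by move=> h; rewrite truth_cjoin; apply: lub_le => _ [V FV <-]; exact: h.
Qed.

Lemma truth_cjoin_meet_le F x a u :
  (forall V, F V -> a `&` truth V x <= u) -> a `&` truth (cjoin F) x <= u.
Proof.
by move=> h; rewrite truth_cjoin; apply: lub_meet_le => _ [V FV <-]; exact: h.
Qed.

Lemma truth_cjoin_sub F G x :
  F `<=` G -> truth (cjoin F) x <= truth (cjoin G) x.
Proof. by move=> FG; apply: truth_cjoin_le => V /FG; exact: truth_cjoin_ub. Qed.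

Lemma truth_cjoin_glue (K : Type) (a : K -> A) (O : K -> csub X) x :
  truth (cjoin (range (fun k => cmeet (O k) (cX X (a k))))) x =
  lub (range (fun k => truth (O k) x `&` a k)).
Proof.
rewrite truth_cjoin; congr lub; apply/seteqP; split.
  by move=> _ [_ [k _ <-] <-]; exists k; rewrite // truth_cmeet truth_cX.
move=> _ [k _ <-]; exists (cmeet (O k) (cX X (a k))); first by exists k.
by rewrite truth_cmeet truth_cX.
Qed.

Lemma truth_local V a x y :
  cond a x = cond a y -> a `&` truth V x <= truth V y.
Proof.
move=> xy; apply/csub_in_truth.
rewrite -(cond_consistent (leIl _ _) xy); apply/csub_in_truth; exact: leIr.
Qed.

End Truth.

Lemma partition_split (c e : A) : c <= e ->
  partition_of e (fun t : bool => if t then c else e `&` ~` c).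
Proof.
move=> ce; have c0 : c `&` (e `&` ~` c) = \bot by rewrite meetCA meetxC meetx0.
split; last by move=> [] [] //= _; rewrite // meetC.
apply/le_anti/andP; split.
  by apply: lub_le => _ [[] _ <-] //; exact: leIl.
have h : e <= c `|` (e `&` ~` c) by rewrite joinIr joinxC meetx1 leUr.
apply: (le_trans h); rewrite leUx.
by apply/andP; split; apply: lub_ub; [exists true|exists false].
Qed.

Lemma truth_cpreim (X Y : cset A) (f : cfun X Y) (V : csub Y) x :
  truth (cpreim f V) x = truth V (f \top x).
Proof.
apply: truth_unique => c; rewrite -csub_in_truth -cfun_cond.
split=> [[cV [y /cpreim_primE Vy] <-]|Vx].
  by rewrite cfun_res //; apply: csub_in_res.
have cV : c <= dom (cpreim f V).
  by apply: lub_ub; case: Vx => cd Vx; split=> //; exists (cond c x).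
have [y /cpreim_primE Vy] := cpreim_neq0 f V.
have pc := partition_split cV.
(* [cond c x] lives only on [c]; gluing it with the restriction of [y] to the remainder yields an
   element of the primal set that restricts to it. *)
have [z zP] := glue_exists (fun t : bool =>
  if t return X (if t then c else dom (cpreim f V) `&` ~` c)
  then cond c x else res _ y) pc.
split=> //; exists z; last exact: (zP true).
apply/cpreim_primE/(csub_in_glue pc) => t.
rewrite -cfun_res ?(partition_le _ pc) // zP; case: t => //.
by rewrite cfun_res ?leIl //; apply: csub_in_res; rewrite // leIl.
Qed.

End TruthValues.

(** * The truth value of finite coverability *)

Section FiniteCover.
Context d (A : completeBAType d).
Local Open Scope classical_set_scope.
Local Open Scope order_scope.

Section FinCov.
Context (X : cset A).
Implicit Types (V W : csub X) (x y : X \top) (F G : set (csub X)).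

Definition fin_covered F (b : A) : Prop :=
  exists G, [/\ finite_set G, G `<=` F & forall x, b <= truth (cjoin G) x].

(** The supremum need not be attained: different conditions may call for different finite
    subfamilies, as conditional finiteness permits. *)
Definition fincov F : A := lub [set b | fin_covered F b].

Lemma fincov_sub F G : F `<=` G -> fincov F <= fincov G.
Proof.
move=> FG; apply: lub_le => b [D [fD DF bD]]; apply: lub_ub; exists D.
by split=> // V /DF /FG.
Qed.

Lemma fin_covered_fincov F (G : set (csub X)) b : finite_set G -> G `<=` F ->
  (forall x, b <= truth (cjoin G) x) -> b <= fincov F.
Proof. by move=> fG GF bG; apply: lub_ub; exists G. Qed.

Lemma truth_cjoinU F G x :
  truth (cjoin (F `|` G)%classic) x = truth (cjoin F) x `|` truth (cjoin G) x.
Proof.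
apply/le_anti/andP; split.
  apply: truth_cjoin_le => V [FV|GV].
    by apply: (le_trans (truth_cjoin_ub _ FV)); exact: leUl.
  by apply: (le_trans (truth_cjoin_ub _ GV)); exact: leUr.
by rewrite leUx; apply/andP; split; apply: truth_cjoin_sub => V; [left|right].
Qed.

Lemma truth_cjoin1 V x : truth (cjoin [set V]) x = truth V x.
Proof.
apply/le_anti/andP; split; last exact: truth_cjoin_ub.
by apply: truth_cjoin_le => _ ->.
Qed.

Lemma truth_cjoin0 x : truth (cjoin set0) x = \bot.
Proof. by apply/eqP; rewrite -lex0; apply: truth_cjoin_le => V []. Qed.

(** Exchange principle: in a finite covering subfamily the members of [G] can stand in for [V],
    since on [e] they cover all that [V] does. *)
Lemma fincov_replace e V F F' G : F `<=` F' -> finite_set G -> G `<=` F' ->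
  (forall x, e `&` truth V x <= truth (cjoin G) x) ->
  e `&` fincov (V |` F) <= fincov F'.
Proof.
move=> FF' fG GF' h; apply: lub_meet_le => b [D [fD DF bD]].
apply: (@fin_covered_fincov _ ((D `&` F) `|` G)%classic).
- by rewrite finite_setU; split=> //; apply: finite_setIl.
- by move=> W [[_ /FF']|/GF'].
move=> x; rewrite truth_cjoinU.
apply: (le_trans (leI2 (lexx e) (bD x))).
apply: truth_cjoin_meet_le => W DW; have [WV|FW] := DF W DW.
  by rewrite WV; apply: (le_trans (h x)); exact: leUr.
apply: (le_trans (leIr _ _)); apply: (le_trans _ (leUl _ _)).
exact: truth_cjoin_ub.
Qed.

Lemma fincov_le e V W F : (forall x, e `&` truth V x <= truth W x) ->
  e `&` fincov (V |` F) <= fincov (W |` F).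
Proof.
move=> h; apply: (@fincov_replace _ _ _ _ [set W]).
- by move=> U; right.
- exact: finite_set1.
- by move=> U ->; left.
by move=> x; rewrite truth_cjoin1.
Qed.

Lemma fincov_remove e V F : (forall x, e `&` truth V x = \bot) ->
  e `&` fincov (V |` F) <= fincov F.
Proof.
move=> h; apply: (@fincov_replace _ _ _ _ set0) => //.
by move=> x; rewrite h le0x.
Qed.

(** If a finite [D] chosen from [V] and [F] covers on [b], then on [b] the set [W] is covered by
    [cmeet V W] and the members of [D] in [F]; this finite family replaces [W]. *)
Lemma fincov_cmeet V W F :
  fincov (V |` F) `&` fincov (W |` F) <= fincov (cmeet V W |` F).
Proof.
rewrite meetC; apply: lub_meet_le => b [D [fD DF bD]]; rewrite meetC.
apply: (@fincov_replace _ _ _ _ (cmeet V W |` (D `&` F)%classic)).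
- by move=> U; right.
- by rewrite finite_setU; split; [exact: finite_set1|exact: finite_setIl].
- by move=> U [->|[_ FU]]; [left|right].
move=> x; apply: (le_trans (leI2 (bD x) (lexx _))).
rewrite meetC; apply: truth_cjoin_meet_le => U DU; have [UV|FU] := DF U DU.
  rewrite UV meetC -truth_cmeet; apply: truth_cjoin_ub; by left.
by apply: (le_trans (leIr _ _)); apply: truth_cjoin_ub; right.
Qed.

End FinCov.

Section Topology.
Context (X : cset A) (T : set (csub X)).
Context (topT : ctopology T).

Lemma ctop_meet_cX V (a : A) : T V -> T (cmeet V (cX X a)).
Proof.
(* [V] on [a] is glued with the least conditional subset on the complement. *)
move=> TV; pose O (t : bool) := if t then V else cbot X.
have := ctop_glue topT (partition_split (lex1 a)) (O := O).
have OT t : T (O t) by case: t => //; exact: ctop_bot.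
move=> /(_ OT); congr T; apply: truth_inj => x.
rewrite truth_cjoin_glue truth_cmeet truth_cX; apply/le_anti/andP; split.
  by apply: lub_le => _ [[] _ <-] //=; rewrite truth_cX meet0x le0x.
by apply: lub_ub; exists true.
Qed.

Lemma ctop_cX (a : A) : T (cX X a).
Proof.
have := ctop_meet_cX a (ctop_full topT); congr T; apply: truth_inj => x.
by rewrite truth_cmeet !truth_cX meet1x.
Qed.

End Topology.

End FiniteCover.

(** * Conditional sets carved out by a stable set of global points *)

Section SubConditionalSet.
Context d (A : completeBAType d) (Y : cset A).
Local Open Scope classical_set_scope.
Local Open Scope order_scope.

Context (P : set (Y \top)) (P_neq0 : P !=set0)
  (P_glue : forall (K : Type) (a : K -> A), partition_of \top a ->
    forall (x : Y \top) (y : K -> Y \top), (forall k, P (y k)) ->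
    (forall k, cond (a k) x = cond (a k) (y k)) -> P x).

Definition subcset_sort (a : A) : Type :=
  {y : Y a | exists2 x, P x & cond a x = y}.

Lemma subcset_ext a (y z : subcset_sort a) : sval y = sval z -> y = z.
Proof. by case: y z => [y p] [z q] /= e; exact: eq_exist. Qed.

Lemma subcset_topP (y : subcset_sort \top) : P (sval y).
Proof. by case: y => y /= [x Px <-]; rewrite cond1. Qed.

Definition subcset_in a (x : Y \top) (Px : P x) : subcset_sort a :=
  exist _ (cond a x) (ex_intro2 _ _ x Px erefl).

Definition subcset_cond a (y : subcset_sort \top) : subcset_sort a :=
  subcset_in a (subcset_topP y).

Lemma subcset_bot : exists x : subcset_sort \bot, forall y, y = x.
Proof.
have [x Px] := P_neq0; exists (subcset_in \bot Px) => y.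
exact/subcset_ext/csort0_eq.
Qed.

Lemma subcset_surj a (y : subcset_sort a) : exists z, subcset_cond a z = y.
Proof.
case: y => y [x Px xy]; exists (subcset_in \top Px).
by apply: subcset_ext; rewrite /= cond1.
Qed.

Lemma subcset_cond1 y : subcset_cond \top y = y.
Proof. by apply: subcset_ext; rewrite /= cond1. Qed.

Lemma subcset_consistent (a b : A) (y z : subcset_sort \top) : a <= b ->
  subcset_cond b y = subcset_cond b z -> subcset_cond a y = subcset_cond a z.
Proof.
move=> ab e; apply: subcset_ext; apply: (cond_consistent ab).
exact: (congr1 (fun t => sval t) e).
Qed.

Lemma subcset_stable (K : Type) (a : K -> A) : partition_of \top a ->
  forall y : (forall k, subcset_sort (a k)),
  exists! z : subcset_sort \top, forall k, subcset_cond (a k) z = y k.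
Proof.
move=> pa y; have [z [zy zu]] := cond_stable pa (fun k => sval (y k)).
have Pz : P z.
  apply: (P_glue pa (y := fun k => s2val (cid2 (svalP (y k))))) => k.
    by case: cid2.
  by case: cid2 => x /= _ ->.
exists (subcset_in \top Pz); split.
  by move=> k; apply: subcset_ext; rewrite /= cond1.
move=> t tk; apply: subcset_ext; rewrite /= cond1; apply: zu => k.
by rewrite -tk.
Qed.

Definition subcset : cset A := CSet subcset_bot subcset_surj subcset_cond1
  subcset_consistent subcset_stable.

Definition subcset_incl : cfun subcset Y :=
  @CFun _ _ subcset Y (fun a y => sval y) (fun a y => erefl).

End SubConditionalSet.

(** * Reduction of conditional compactness to ordinary covers *)

Section Compactness.
Context d (A : completeBAType d) (X : ctopspace A).
Local Open Scope classical_set_scope.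
Local Open Scope order_scope.
Implicit Types (F G : set (csub X)) (V W : csub X).

(** [F] need not be stable under gluing, so it cannot itself serve as a conditional index set. This
    weakening of membership is stable, yet still leads back to finite subfamilies of [F]. *)
Definition locally_fincovered F V : Prop :=
  lub [set b | exists G, [/\ finite_set G, G `<=` F &
    forall x, b `&` truth V x <= truth (cjoin G) x]] = \top.

Lemma locally_fincovered_member F V : F V -> locally_fincovered F V.
Proof.
move=> FV; apply/eqP; rewrite -le1x; apply: lub_ub; exists [set V].
by split=> [|W ->//|x]; rewrite ?truth_cjoin1 ?leIr //; exact: finite_set1.
Qed.

Lemma locally_fincovered_cbot F : locally_fincovered F (cbot X).
Proof.
apply/eqP; rewrite -le1x; apply: lub_ub; exists set0.
by split=> // x; rewrite truth_cX meetx0 le0x.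
Qed.

Lemma locally_fincovered_glue F (K : Type) (a : K -> A) (V : K -> csub X) W :
  partition_of \top a -> (forall k, locally_fincovered F (V k)) ->
  (forall k x, a k `&` truth W x <= truth (V k) x) ->
  locally_fincovered F W.
Proof.
move=> pa FV WV; apply/eqP; rewrite -le1x.
apply: (partition_meet_le pa) => // k.
rewrite meet1x; apply: (le_lub_top (FV k)) => b [G [fG GF bG]].
apply: lub_ub; exists G; split=> // x.
rewrite [a k `&` b]meetC -meetA; apply: (le_trans _ (bG x)).
by apply: leI2 => //; exact: WV.
Qed.

Lemma locally_fincovered_cjoin F G : finite_set G ->
  (forall V, G V -> locally_fincovered F V) -> locally_fincovered F (cjoin G).
Proof.
move: G; apply: finite_set_induction => [_|V G IHG FG].
  apply/eqP; rewrite -le1x; apply: lub_ub; exists set0.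
  by split=> // x; rewrite truth_cjoin0 meetx0 le0x.
have {}IHG : locally_fincovered F (cjoin G).
  by apply: IHG => W GW; apply: FG; right.
have FV := FG V (or_introl erefl).
apply/eqP; rewrite -le1x; apply: (le_lub_top FV) => b [D [fD DF bD]].
rewrite meet1x; apply: (le_lub_top IHG) => c [E [fE EF cE]].
apply: lub_ub; exists (D `|` E)%classic; split.
- by rewrite finite_setU.
- by move=> W [/DF|/EF].
move=> x; rewrite [leRHS]truth_cjoinU.
apply: truth_cjoin_meet_le => W [->|GW].
  apply: (le_trans _ (leUl _ _)); apply: (le_trans _ (bD x)).
  by apply: leI2 => //; exact: leIl.
apply: (le_trans _ (leUr _ _)); apply: (le_trans _ (cE x)).
by apply: leI2; [exact: leIr|exact: truth_cjoin_ub].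
Qed.

Lemma csubset_cX (b : A) V : csubset (cX X b) V <-> forall x, b <= truth V x.
Proof. by rewrite csubset_truth; split=> h x; have := h x; rewrite truth_cX. Qed.

Lemma cpow_cond_truth (a : A) (V W : cpow X \top) : cond a V = cond a W ->
  forall x, a `&` truth (sval V) x = a `&` truth (sval W) x.
Proof.
move=> e x; have := congr1 (fun U : cpow X a => truth (sval U) x) e.
by rewrite /= !truth_cmeet truth_cX ![_ `&` a]meetC.
Qed.

Lemma glue_open (K : Type) (a : K -> A) (O : K -> csub X) W :
  partition_of \top a -> (forall k, copen (O k)) ->
  (forall k x, a k `&` truth W x = a k `&` truth (O k) x) -> copen W.
Proof.
move=> pa oO WO; have := ctop_glue (copenP X) pa oO; congr copen.
apply: truth_inj => x; rewrite truth_cjoin_glue.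
apply/le_anti/andP; split.
  by apply: lub_le => _ [k _ <-]; rewrite meetC -WO leIr.
apply: (partition_meet_le pa) => [|k]; first exact: lex1.
by rewrite meetC WO meetC; apply: lub_ub; exists k.
Qed.

(* A cover F generates the conditional index set of all open sets that are
   locally finitely covered by F, so plain covers suffice to test
   conditional compactness. *)
Lemma ccompactP : ccompact X <-> forall F, F `<=` copen (c := X) ->
  (forall x, truth (cjoin F) x = \top) -> fincov F = \top.
Proof.
split=> [cX F Fo Fc|h J O oO].
  pose P : set (cpow X \top) := [set V | copen (sval V) /\
    locally_fincovered F (sval V)].
  have P0 : P !=set0.
    exists (cpow_in (lex1 (dom (cbot X)))); split.
      exact: (ctop_bot (copenP X)).
    exact: locally_fincovered_cbot.
  have Pg (K : Type) (a : K -> A) : partition_of \top a ->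
      forall (V : cpow X \top) (W : K -> cpow X \top), (forall k, P (W k)) ->
      (forall k, cond (a k) V = cond (a k) (W k)) -> P V.
    move=> pa V W PW VW; have VWx k := cpow_cond_truth (VW k).
    split; first by apply: (glue_open pa _ VWx) => k; case: (PW k).
    apply: (locally_fincovered_glue pa (V := fun k => sval (W k))).
      by move=> k; case: (PW k).
    by move=> k x; rewrite VWx leIr.
  have [j||K [a [J' [pa fJ' J'c]]]] := cX _ (subcset_incl P0 Pg).
  - by case: (subcset_topP j).
  - apply/csubset_cX => x; apply: (@le_trans _ _ (truth (cjoin F) x)).
      by rewrite Fc.
    apply: truth_cjoin_le => V FV.
    have PV : P (cpow_in (lex1 (dom V))).
      by split; [exact: Fo|exact: locally_fincovered_member].
    apply: truth_cjoin_ub; exists (subcset_in \top PV) => //=.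
    exact: cmeet_cX_id (lex1 _).
  apply/eqP; rewrite -le1x; apply: (partition_meet_le pa) => // k.
  (* The finite family [G] covers on [a k], and its join is locally finitely covered by [F]; so [F]
     finitely covers locally below [a k]. *)
  rewrite meet1x; set G := [set sval (sval j) | j in J' k].
  have : locally_fincovered F (cjoin G).
    apply: locally_fincovered_cjoin; first exact: finite_image.
    by move=> _ [j _ <-]; case: (subcset_topP j).
  move=> GF; apply: (le_lub_top GF) => b [D [fD DF bD]].
  apply: (fin_covered_fincov fD DF) => x; apply: (le_trans _ (bD x)).
  rewrite meetC; apply: leI2 => //.
  move/csubset_cX: (J'c k) => /(_ x) /le_trans; apply.
  apply: truth_cjoin_le => _ [j Jj <-]; rewrite truth_cmeet.
  by apply: (le_trans (leIl _ _)); apply: truth_cjoin_ub; exists j.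
move=> /csubset_cX cJ; pose F := range (fun j : J \top => sval (O \top j)).
have Fo : F `<=` copen (c := X) by move=> _ [j _ <-].
have Fc x : truth (cjoin F) x = \top by apply/eqP; rewrite -le1x.
(* Exhaustion cuts [\top] into conditions on each of which one finite subfamily covers. *)
have [b c bc [G [fG GF cG]]|K [a [pa aG]]] :=
    @exhaustion _ A [set b | fin_covered F b].
  by exists G; split=> // x; exact: le_trans (cG x).
rewrite [lub _](h F Fo Fc) in pa.
(* [g] selects an index for each member of [F]; outside [F] it takes the arbitrary value [j0]. *)
have [g gP] : exists g : csub X -> J \top,
    forall V, F V -> sval (O \top (g V)) = V.
  have [z _] := cset0 J; have [j0 _] := condE z.
  exists (fun V => if pselect (F V) is left FV then s2val (cid2 FV) else j0).
  by move=> V FV; case: pselect => // {}FV; case: cid2.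
pose G k := sval (cid (aG k)).
have GP k : [/\ finite_set (G k), G k `<=` F &
    forall x, a k <= truth (cjoin (G k)) x].
  by rewrite /G; case: cid.
exists K, a, (fun k => g @` G k); split=> // k.
  by have [fG _ _] := GP k; exact: finite_image.
have [_ GF aGk] := GP k.
apply/csubset_cX => x.
apply: (@le_trans _ _ (a k `&` truth (cjoin (G k)) x)).
  by rewrite lexI lexx aGk.
apply: truth_cjoin_meet_le => V GV.
have -> : a k `&` truth V x =
    truth (cmeet (sval (O \top (g V))) (cX X (a k))) x.
  by rewrite truth_cmeet truth_cX (gP _ (GF _ GV)) meetC.
by apply: truth_cjoin_ub; exists (g V) => //; exact: imageP.
Qed.

End Compactness.

(** * Maximal families and products *)

Section Tychonoff.
Context d (A : completeBAType d).
Local Open Scope classical_set_scope.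
Local Open Scope order_scope.

(** Maximum principle in dual form: points avoiding [V] on various conditions glue to one [z]
    avoiding [V] on the supremum of all such conditions. *)
Lemma truth_min (Y : cset A) (V : csub Y) :
  exists z : Y \top, forall x, truth V z <= truth V x.
Proof.
pose C := [set b | exists x : Y \top, b `&` truth V x = \bot].
have [b c bc [x cx]|K [a [pa aC]]] := @exhaustion _ A C.
  exists x; apply/eqP; rewrite -lex0 -cx; exact: leI2.
have [y yP] := glue_exists (fun k => cond (a k) (projT1 (cid (aC k)))) pa.
have [z yz] := condE y; exists z => x.
have Vz : lub C `&` truth V z <= \bot.
  apply: (partition_meet_le pa); first exact: leIl.
  move=> k; have := yP k; case: (cid (aC k)) => w /= aw.
  rewrite yz res_cond ?(partition_le _ pa) // => zw.
  rewrite -aw lexI; apply/andP; split; first exact: leIr.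
  apply: (le_trans _ (truth_local V zw)).
  by rewrite meetC; apply: leI2 => //; exact: leIr.
(* The complement of [truth V x] belongs to [C], with [x] as witness. *)
apply: le_compl_meet; rewrite meetC; apply: (le_trans _ Vz); apply: leI2 => //.
by apply: lub_ub; exists x; rewrite meetC meetxC.
Qed.

Lemma ccompact_local (Y : ctopspace A) (F : set (csub Y)) (b : A) :
  ccompact Y -> F `<=` copen (c := Y) ->
  (forall x, b <= truth (cjoin F) x) -> b <= fincov F.
Proof.
move=> /ccompactP cY Fo bF; pose V := cX Y (~` b).
have FVo : V |` F `<=` copen (c := Y).
  by move=> W [->|/Fo//]; exact: (ctop_cX (copenP Y)).
have bV x : b `&` truth V x = \bot by rewrite truth_cX meetxC.
apply: (le_trans _ (fincov_remove F bV)); rewrite lexI lexx cY ?lex1 // => x.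
apply/eqP; rewrite -le1x truth_cjoinU truth_cjoin1 truth_cX -(joinCx b).
by apply: leU2.
Qed.

Lemma maximal_fincov (Y : cset A) (T F : set (csub Y)) : F `<=` T ->
  exists M, [/\ F `<=` M, M `<=` T, fincov M <= fincov F &
    forall V, T V -> fincov (V |` M) <= fincov F -> M V].
Proof.
(* [F] is adjoined to [D] rather than required inside it, so that the union of the empty chain
   qualifies. *)
move=> FT; pose P := [set D | D `<=` T /\ fincov (F `|` D)%classic <= fincov F].
have [C CP Ct|M [[MT FM] Mmax]] := @Zorn_bigcup _ P.
  split=> [V [D /CP[DT _] /DT]//|]; apply: lub_le => b [G [fG GFC bG]].
  have [GF|[D CD GD]] := finite_subset_bigcup_chain Ct fG GFC.
    exact: (fin_covered_fincov fG GF).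
  have /CP[_ FD] := CD; apply: (le_trans _ FD).
  exact: (fin_covered_fincov fG GD).
exists (F `|` M)%classic; split=> //.
- by move=> V [/FT|/MT].
move=> V TV VM; right; apply: contrapT => MV.
apply: (Mmax (V |` M)).
  by split; [move=> W; right|move=> /(_ V (or_introl erefl))].
split; first by move=> W [->|/MT].
by rewrite setUCA.
Qed.

(** This takes the place of a subbase lemma: the product topology being the smallest one, only
    preimages under projections remain to be tested. Gluings and joins follow from monotonicity of
    [fincov] in the added set, meets from [fincov_cmeet]. *)
Lemma ctopology_fincov (Y : cset A) (M : set (csub Y)) (x : Y \top) :
  ctopology [set V | truth V x <= fincov (V |` M)].
Proof.
split=> /=.
- by rewrite truth_cX le0x.
- apply: (@fin_covered_fincov _ _ _ _ [set cX Y \top]).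
  + exact: finite_set1.
  + by move=> W ->; left.
  + by move=> y; rewrite truth_cjoin1 !truth_cX.
- move=> K a pa O OM; rewrite truth_cjoin_glue; apply: lub_le => _ [k _ <-].
  rewrite meetC; apply: (le_trans (leI2 (lexx _) (OM k))).
  apply: fincov_le => y.
  by rewrite truth_cjoin_glue meetC; apply: lub_ub; exists k.
- move=> V W VM WM; rewrite truth_cmeet.
  exact: (le_trans (leI2 VM WM) (fincov_cmeet _ _ _)).
- move=> F FM; apply: truth_cjoin_le => V FV; apply: (le_trans (FM _ FV)).
  rewrite -[leLHS]meet1x; apply: fincov_le => y; rewrite meet1x.
  exact: truth_cjoin_ub.
Qed.

Context (I : Type) (X : I -> ctopspace A).

Lemma truth_cproj i (V : csub (X i)) (x : ctop_prod X \top) :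
  truth (cpreim (cproj X i) V) x = truth V (x i).
Proof. exact: truth_cpreim. Qed.

Lemma cprod_extend i (y : X i \top) : exists x : ctop_prod X \top, x i = y.
Proof.
(* Coordinate [i] receives [y], transported along [i = j]; the others are arbitrary. *)
have h j : exists z : X j \top,
    forall e : i = j, eq_rect i (fun k => X k \top) y j e = z.
  have [ij|ij] := pselect (i = j).
    by subst j; exists y => e; rewrite (Prop_irrelevance e erefl).
  by have [z _] := cX_neq0 (X j) \top; exists z => e; case: (ij e).
exists (fun j => projT1 (cid (h j))); case: cid => z /= zP.
by rewrite -(zP erefl).
Qed.

Lemma cpreim_cproj_inj i : injective (cpreim (cproj X i)).
Proof.
move=> V W VW; apply: truth_inj => y; have [x <-] := cprod_extend y.
by rewrite -!truth_cproj VW.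
Qed.

Lemma truth_cjoin_cproj i (F : set (csub (X i))) (x : ctop_prod X \top) :
  truth (cjoin [set cpreim (cproj X i) V | V in F]) x = truth (cjoin F) (x i).
Proof.
rewrite !truth_cjoin; congr lub; apply/seteqP; split.
  by move=> _ [_ [V FV <-] <-]; rewrite truth_cproj; exact: imageP.
move=> _ [V FV <-]; rewrite -truth_cproj.
by apply: imageP; exact: imageP.
Qed.

(** Projections are surjective on global points, so taking preimages is injective and both preserves
    and reflects covering; finite subfamilies correspond. *)
Lemma fincov_cproj i (F : set (csub (X i))) :
  fincov [set cpreim (cproj X i) V | V in F] = fincov F.
Proof.
congr lub; apply/seteqP; split=> b [G [fG GF bG]].
  exists (cpreim (cproj X i) @^-1` G); split.
  - by apply: finite_preimage => // V W _ _; exact: cpreim_cproj_inj.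
  - by move=> V /GF[W FW /cpreim_cproj_inj <-].
  move=> y; have [x <-] := cprod_extend y.
  rewrite -truth_cjoin_cproj; apply: (le_trans (bG x)).
  apply: truth_cjoin_sub => V GV.
  by have [W FW WV] := GF _ GV; exists W => //=; rewrite WV.
exists [set cpreim (cproj X i) V | V in G]; split.
- exact: finite_image.
- by move=> _ [V GV <-]; apply: imageP; exact: GF.
- by move=> x; rewrite truth_cjoin_cproj.
Qed.

Lemma cpreim_cX i (V : csub (X i)) (a : A) :
  cpreim (cproj X i) (cmeet V (cX (X i) a)) =
  cmeet (cpreim (cproj X i) V) (cX (ctop_prod X) a).
Proof.
by apply: truth_inj => x; rewrite truth_cproj !truth_cmeet truth_cproj !truth_cX.
Qed.

Lemma ccompact_cproj i : ccompact (ctop_prod X) -> ccompact (X i).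
Proof.
move=> /ccompactP cX; apply/ccompactP => F Fo Fc.
rewrite -fincov_cproj; apply: cX => [_ [V FV <-]|x].
  by apply: cproj_continuous; exact: Fo.
by rewrite truth_cjoin_cproj.
Qed.

Lemma ccompact_cprod : (forall i, ccompact (X i)) -> ccompact (ctop_prod X).
Proof.
move=> cX; apply/ccompactP => F Fo Fc.
have [M [FM Mo Me Mmax]] := maximal_fincov Fo.
pose Mi i := [set V | copen V /\ M (cpreim (cproj X i) V)].
(* On the minimal truth value, [Mi i] covers the whole factor, so compactness bounds that value by
   [fincov (Mi i)], hence by [fincov M]. *)
have [x xP] : exists x : ctop_prod X \top,
    forall i, truth (cjoin (Mi i)) (x i) <= fincov F.
  exists (fun i => projT1 (cid (truth_min (cjoin (Mi i))))) => i.
  case: cid => z /= zmin; apply: (le_trans _ Me).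
  have := ccompact_local (cX i) _ zmin; move=> /(_ _)/le_trans; apply.
    by move=> V [].
  by rewrite -fincov_cproj; apply: fincov_sub => _ [V [_ MV] <-].
have xM : forall V, copen (c := ctop_prod X) V -> truth V x <= fincov (V |` M).
  move=> V oV; apply: (oV _ (ctopology_fincov M x)) => i {oV}V oV /=.
  set W := cpreim _ V; set s := fincov _.
  have es : fincov F <= s.
    by apply: fincov_sub => U /FM; right.
  (* Cut down to the complement of [s], the preimage can be added to [M] freely: the new [fincov]
     stays below [s], and on [s] the added set contributes nothing. *)
  have MW : M (cpreim (cproj X i) (cmeet V (Defs.cX (X i) (~` s)))).
    rewrite cpreim_cX -/W; set W' := cmeet _ _; apply: Mmax.
      apply: (ctop_meet_cX (copenP (ctop_prod X))).
      exact: cproj_continuous.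
    have sM : fincov (W' |` M) <= s.
      rewrite -[leLHS]meet1x; apply: fincov_le => y.
      by rewrite meet1x truth_cmeet leIl.
    apply: (le_trans _ Me); rewrite -(meet_r sM); apply: fincov_remove => y.
    by rewrite truth_cmeet truth_cX meetCA meetxC meetx0.
  have := xP i; rewrite /W truth_cproj => xi.
  (* By [MW] the part of [V] off [s] lies in [Mi i], so [xP] bounds its truth value; an element
     whose part off [s] is below [s] is itself below [s]. *)
  have Vs : truth V (x i) `&` ~` s <= s.
    apply: (le_trans _ es); apply: (le_trans _ xi).
    rewrite -(truth_cX (~` s) (x i)) -truth_cmeet; apply: truth_cjoin_ub.
    by split=> //; apply: ctop_meet_cX oV; exact: copenP.
  by move: Vs; rewrite meetC le_residual complK joinxx.
apply/eqP; rewrite -le1x -(Fc x); apply: truth_cjoin_le => V FV.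
apply: (le_trans (xM V (Fo V FV))); apply: (le_trans _ Me).
by apply: fincov_sub => W [->|//]; exact: FM.
Qed.

End Tychonoff.

Theorem theorem3p20 (d : Order.disp_t) (A : completeBAType d)
    (nontrivial : \bot != \top :> A)
    (I : Type) (I_nonempty : inhabited I) (X : I -> ctopspace A) :
  ccompact (ctop_prod X) <-> forall i : I, ccompact (X i).
Proof.
by split=> [cX i|cX]; [exact: ccompact_cproj|exact: ccompact_cprod].
Qed.
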